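(* Let $m\ge 3$, $n\ge 3$, let $x,y$ be two distinct vertices of the cycle $C_m$ with $p=d(x,y)$ (graph distance in $C_m$), and let $F_n(C_m)$ be the generalized sunflower graph formed from $n$ copies of $C_m$ with marked vertices $x,y$. The Kirchhoff index of $F_n(C_m)$ is $$Kf(F_n(C_m))=\frac{n(pm-p^2)\left(n^2(m-1)^2+m^2(4-6n)+6mn-1\right)}{12m}-\frac{n\left(m^3+m-2-2n(m-1)^2(m+1)\right)}{12}.$$
   Context: For a connected graph $H$ with vertex set $\{1,\dots,N\}$ and Laplacian matrix $L$, the resistance distance between vertices $i,j$ is $r_H(i,j)=(e_i-e_j)^T L^\dagger (e_i-e_j)$, where $e_i$ is the $i$th standard unit vector and $L^\dagger$ is the Moore–Penrose pseudoinverse of $L$. The Kirchhoff index is $Kf(H)=\frac12\sum_{i,j\in V(H)} r_H(i,j)$ (sum over ordered pairs). Generalized sunflower graph: fix distinct vertices $x,y$ of the cycle $C_m$. $F_n(C_m)$ is obtained from $n$ vertex-disjoint copies of $C_m$, labelled $1,\dots,n$, with $x_i,y_i$ the copies of $x,y$ in the $i$th copy, by identifying $y_i$ with $x_{i+1}$ for $1\le i<n$ and $y_n$ with $x_1$. *)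

(* Defs.v *)
From mathcomp Require Import all_boot all_order all_algebra.

Set Implicit Arguments.
Unset Strict Implicit.
Unset Printing Implicit Defensive.

Import Order.TTheory GRing.Theory Num.Theory.
Local Open Scope ring_scope.

(* Over a real field conjugate transposition is plain transposition, so these
   are the four Penrose equations; existence and uniqueness are proved below. *)
Definition penrose (R : realFieldType) (m n : nat)
    (A : 'M[R]_(m, n)) (X : 'M[R]_(n, m)) : bool :=
  [&& A *m X *m A == A, X *m A *m X == X,
      (A *m X)^T == A *m X & (X *m A)^T == X *m A].

Lemma row_free_gram_unit (R : realFieldType) (m n : nat) (B : 'M[R]_(m, n)) :
  row_free B -> B *m B^T \in unitmx.
Proof.
move=> Bfree; rewrite -row_free_unit -kermx_eq0; apply/eqP/row_matrixP=> i.
rewrite row0; set u := row i _.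
have uG0 : u *m (B *m B^T) = 0.
  by apply/sub_kermxP; exact: row_sub.
have : (u *m B) *m (u *m B)^T = 0.
  by rewrite trmx_mul !mulmxA -[u *m B *m _]mulmxA uG0 mul0mx.
move/matrixP/(_ 0 0); rewrite !mxE => /eqP.
rewrite psumr_eq0 => [/allP w0|j _]; last first.
  by rewrite [_^T _ _]mxE -expr2 sqr_ge0.
have uB0 : u *m B = 0.
  apply/rowP=> j; rewrite [RHS]mxE; have := w0 j (mem_index_enum j).
  by rewrite [_^T _ _]mxE -expr2 sqrf_eq0 => /eqP.
by apply: (row_free_inj Bfree); rewrite uB0 mul0mx.
Qed.

Lemma penrose_full_rank (R : realFieldType) (m n r : nat)
    (C : 'M[R]_(m, r)) (B : 'M[R]_(r, n)) : row_full C -> row_free B ->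
  penrose (C *m B)
    (B^T *m invmx (B *m B^T) *m invmx (C^T *m C) *m C^T).
Proof.
move=> Cfull Bfree; set G := B *m B^T; set H := C^T *m C.
have uG : G \in unitmx by exact: row_free_gram_unit.
have uH : H \in unitmx.
  by rewrite /H -{2}[C]trmxK row_free_gram_unit // /row_free mxrank_tr.
have GT : (invmx G)^T = invmx G by rewrite trmx_inv /G trmx_mul trmxK.
have HT : (invmx H)^T = invmx H by rewrite trmx_inv /H trmx_mul trmxK.
set X := _ *m C^T.
have AX : C *m B *m X = C *m invmx H *m C^T.
  by rewrite /X !mulmxA -(mulmxA C B) -/G mulmxK.
have XA : X *m (C *m B) = B^T *m invmx G *m B.
  by rewrite /X !mulmxA -(mulmxA _ C^T C) -/H mulmxKV.
rewrite /penrose AX XA; apply/and4P; split; apply/eqP.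
- by rewrite !mulmxA -(mulmxA _ C^T C) -/H mulmxKV.
- by rewrite /X !mulmxA -(mulmxA _ B B^T) -/G mulmxKV.
- by rewrite !trmx_mul trmxK HT mulmxA.
- by rewrite !trmx_mul trmxK GT mulmxA.
Qed.

Lemma penrose_exists (R : realFieldType) (m n : nat) (A : 'M[R]_(m, n)) :
  exists X, penrose A X.
Proof.
have := penrose_full_rank (col_base_full A) (row_base_free A).
by rewrite mulmx_base => AX; eexists; exact: AX.
Qed.

Lemma penrose_unique (R : realFieldType) (m n : nat) (A : 'M[R]_(m, n))
    (X Y : 'M[R]_(n, m)) : penrose A X -> penrose A Y -> X = Y.
Proof.
move=> /and4P[/eqP X1 /eqP X2 /eqP X3 /eqP X4].
move=> /and4P[/eqP Y1 /eqP Y2 /eqP Y3 /eqP Y4].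
have E1 : A *m X = A *m Y.
  by rewrite -X3 -{1}Y1 -mulmxA trmx_mul X3 Y3 mulmxA X1.
have E2 : X *m A = Y *m A.
  by rewrite -X4 -{1}Y1 !mulmxA -(mulmxA (X *m A)) trmx_mul X4 Y4 -mulmxA (mulmxA A) X1.
by rewrite -X2 E2 -mulmxA E1 mulmxA Y2.
Qed.

Definition mpinv (R : realFieldType) (m n : nat) (A : 'M[R]_(m, n)) :
  'M[R]_(n, m) := xchoose (penrose_exists A).

Lemma mpinvP (R : realFieldType) (m n : nat) (A : 'M[R]_(m, n)) :
  penrose A (mpinv A).
Proof. exact: xchooseP. Qed.

(* A graph is a finite vertex type T with a symmetric irreflexive e : rel T.
   Matrices are indexed by 'I_#|T| through enum_rank / enum_val. *)
Section Graphs.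

Variables (T : finType) (e : rel T).

(* Junk value #|T| when y is not reachable from x; otherwise see gdistP. *)
Definition gdist (x y : T) : nat :=
  find (fun k => [exists s : k.-tuple T, path e x s && (last x s == y)])
       (iota 0 #|T|).

Lemma gdistP (x y : T) : connect e x y ->
  (exists s, [/\ path e x s, last x s = y & size s = gdist x y])
  /\ (forall s, path e x s -> last x s = y -> (gdist x y <= size s)%N).
Proof.
move=> cxy; rewrite /gdist; set a := (fun k : nat => _).
have aP s : path e x s -> last x s = y -> a (size s).
  by move=> es ls; apply/existsP; exists (in_tuple s); rewrite /= es ls eqxx.
have ha : has a (iota 0 #|T|).
  have /connectP[s0 es0 ys0] := cxy; case: (shortenP es0) ys0 => s es us _ ys.
  apply/hasP; exists (size s); last exact: aP.
  by rewrite mem_iota /= add0n -[(size s).+1]/(size (x :: s)) -(card_uniqP us) max_card.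
have lt_a : (find a (iota 0 #|T|) < #|T|)%N by rewrite has_find size_iota in ha.
split.
  have := nth_find 0%N ha; rewrite nth_iota // add0n => /existsP[s /andP[es /eqP ls]].
  by exists s; rewrite es ls size_tuple.
move=> s es ls; rewrite leqNgt; apply/negP=> lt_s.
have := before_find 0%N lt_s.
by rewrite nth_iota ?(ltn_trans lt_s) // add0n aP.
Qed.

Definition degree (x : T) : nat := #|[set y | e x y]|.

Definition laplacian (R : realFieldType) : 'M[R]_#|T| :=
  \matrix_(i, j) ((degree (enum_val i))%:R *+ (i == j)
                  - (e (enum_val i) (enum_val j))%:R).

Definition unit_vec (R : realFieldType) (x : T) : 'cV[R]_#|T| :=
  delta_mx (enum_rank x) 0.

Definition resistance (R : realFieldType) (x y : T) : R :=
  ((unit_vec R x - unit_vec R y)^T *m mpinv (laplacian R)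
     *m (unit_vec R x - unit_vec R y)) 0 0.

Definition kirchhoff (R : realFieldType) : R :=
  2^-1 * \sum_(x : T) \sum_(y : T) resistance R x y.

End Graphs.

Definition cycle_rel (m : nat) : rel 'I_m :=
  [rel i j | (j == ordS i) || (i == ordS j)].

(* Vertex identification: g relates vertices to be merged; the new vertices are
   the classes of the equivalence relation generated by g. *)
Section Glue.

Variables (T : finType) (e g : rel T).

Definition glue_classes : {set {set T}} :=
  equivalence_partition (connect (relU g [rel u v | g v u])) [set: T].

Definition glue_vertex : finType := {B : {set T} | B \in glue_classes}.

Definition glue_rel : rel glue_vertex := [rel A B : glue_vertex |
  (A != B) && [exists u in val A, exists v in val B, e u v]].

Lemma glue_rel_irr : irreflexive glue_rel.
Proof. by move=> A; rewrite /glue_rel /= eqxx. Qed.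

Lemma glue_rel_sym : symmetric e -> symmetric glue_rel.
Proof.
move=> esym A B; rewrite /glue_rel /= eq_sym; congr andb.
by apply/exists_inP/exists_inP => -[u uA /exists_inP[v vB euv]];
  exists v => //; apply/exists_inP; exists u; rewrite // esym.
Qed.

End Glue.

Section Sunflower.

Variables (m n : nat) (x y : 'I_m).

Definition copies_rel : rel ('I_n * 'I_m) :=
  [rel u v | (u.1 == v.1) && cycle_rel u.2 v.2].

(* y_i is merged with x_(i+1); ordS is the cyclic successor, so the last copy
   is attached to the first one. *)
Definition sunflower_ident : rel ('I_n * 'I_m) :=
  [rel u v | [&& u.2 == y, v.2 == x & v.1 == ordS u.1]].

Definition sunflower_vertex : finType := glue_vertex sunflower_ident.

Definition sunflower_rel : rel sunflower_vertex :=
  @glue_rel _ copies_rel sunflower_ident.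

End Sunflower.

Arguments sunflower_vertex {m} n x y.
Arguments sunflower_rel {m} n x y.

Lemma sunflower_rel_irr (m n : nat) (x y : 'I_m) :
  irreflexive (sunflower_rel n x y).
Proof. exact: glue_rel_irr. Qed.

Lemma sunflower_rel_sym (m n : nat) (x y : 'I_m) :
  symmetric (sunflower_rel n x y).
Proof.
by apply: glue_rel_sym => u v; rewrite /copies_rel /cycle_rel /= eq_sym orbC.
Qed.

(* Main.v *)
Require Import Defs.
From mathcomp Require Import all_boot all_order all_algebra.
From mathcomp Require Import zify ring.
Import Order.TTheory GRing.Theory Num.Theory.
Local Open Scope ring_scope.

(* Resistance distances are recognised by a local equation: a symmetric function
   rho vanishing on the diagonal is the resistance distance as soon as the
   Laplacian of rho(-, v) is -2 times the Dirac mass at v plus a function that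
   does not depend on v.  On the cycle this is satisfied by d (m - d) / m.  In the
   sunflower graph every copy of the cycle acts as a resistor r = p (m - p) / m
   between its terminals, so the copies form a ring of total resistance n r.  Two
   vertices at distance D along the unrolled ring then have resistance
   D - D^2 / (n r) plus the resistances of the stubs joining them to the ring (or
   cycle_res - D^2 / (n r) when they lie in the same copy).  The local equation is
   checked copy by copy, and the Kirchhoff index is the sum of these values over
   the canonical representatives (i, a) with a <> y of the glued vertices. *)

Set Implicit Arguments.
Unset Strict Implicit.
Unset Printing Implicit Defensive.

(** * Recognising resistance distances by a local equation *)

Section Resistance.

Variables (R : realFieldType) (T : finType) (e : rel T).

Lemma laplacian_mul (f : T -> R) (u : T) :
  (laplacian e R *m \col_j f (enum_val j)) (enum_rank u) 0 =
  \sum_(w | e u w) (f u - f w).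
Proof.
rewrite mxE; transitivity (\sum_(j < #|T|)
    ((degree e u)%:R *+ (u == enum_val j) * f (enum_val j)
     - (e u (enum_val j))%:R * f (enum_val j))).
  apply: eq_bigr => j _; rewrite !mxE enum_rankK mulrBl; congr (_ *+ _ * _ - _).
  by rewrite -(inj_eq enum_val_inj) enum_rankK.
rewrite -(reindex _ (onW_bij _ (enum_val_bij T)) (P := xpredT) (F := fun w =>
  (degree e u)%:R *+ (u == w) * f w - (e u w)%:R * f w)) /=.
rewrite !sumrB (bigD1 u) //= eqxx mulr1n big1 ?addr0; last first.
  by move=> w wu; rewrite eq_sym (negPf wu) mulr0n mul0r.
rewrite [in RHS]big_mkcond [X in _ = _ - X]big_mkcond /= -big_mkcond /=.
rewrite sumr_const /degree cardsE mulr_natl; congr (_ - _).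
by apply: eq_bigr => w _; case: ifP => _; rewrite ?mul1r ?mul0r.
Qed.

(** The potential [F] of a unit current solves [L F = e_u - e_v], so the first Penrose equation
    turns the quadratic form into [F^T L F = f u - f v]. *)
Lemma resistance_potential (f : T -> R) (u v : T) : symmetric e ->
  (forall w, \sum_(z | e w z) (f w - f z) = (w == u)%:R - (w == v)%:R) ->
  resistance e R u v = f u - f v.
Proof.
move=> esym Lf; rewrite /resistance; set L := laplacian e R.
set F := \col_j f (enum_val j) : 'cV[R]_#|T|.
have LF : unit_vec R u - unit_vec R v = L *m F.
  apply/colP=> j; rewrite -[j]enum_valK laplacian_mul Lf !mxE !eqxx !andbT.
  by rewrite !(inj_eq enum_rank_inj).
have LT : L^T = L.
  by apply/matrixP=> i j; rewrite !mxE esym eq_sym; case: eqP => // ->.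
have /and4P[/eqP LXL _ _ _] := mpinvP L.
rewrite LF trmx_mul LT mulmxA -!(mulmxA F^T) LXL -LF mulmxBr mxE.
by rewrite /unit_vec -!colE !mxE !enum_rankK.
Qed.

(* The resistance distance itself satisfies the hypotheses, with
   [tau u = 2 - \sum_(w | e u w) rho u w]; hence they determine it. *)
Lemma resistance_eq (rho : T -> T -> R) (tau : T -> R) : symmetric e ->
  (forall u, rho u u = 0) -> (forall u v, rho u v = rho v u) ->
  (forall u v, \sum_(w | e u w) (rho u v - rho w v)
               = tau u - 2 * (u == v)%:R) ->
  forall u v, resistance e R u v = rho u v.
Proof.
move=> esym rho0 rhoC Lrho u v.
(* In half the difference of two columns of [rho], [tau] cancels and only the two point masses
   remain. *)
rewrite (@resistance_potential (fun w => (rho w v - rho w u) / 2)) //.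
  by rewrite !rho0 (rhoC v u); field.
move=> w; transitivity (2^-1 * \sum_(z | e w z)
   ((rho w v - rho z v) - (rho w u - rho z u))).
  by rewrite mulr_sumr; apply: eq_bigr => z _; field.
by rewrite sumrB !Lrho; field.
Qed.

End Resistance.

(** * Laplacian sums on a graph with identified vertices *)

Section Glue.

Variables (T : finType) (e g : rel T) (c : T -> T).
Hypothesis gluedP :
  forall u v, connect (relU g [rel a b | g b a]) u v = (c u == c v).

Lemma glue_class_subproof (u : T) : [set v | c u == c v] \in glue_classes g.
Proof.
by apply/imsetP; exists u => //; apply/setP=> v; rewrite !inE gluedP.
Qed.

Definition glue_class (u : T) : glue_vertex g :=
  exist (fun B => B \in glue_classes g) _ (glue_class_subproof u).

Lemma mem_glue_class (u v : T) : (v \in val (glue_class u)) = (c u == c v).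
Proof. by rewrite inE. Qed.

Lemma glue_class_eq (u v : T) : (glue_class u == glue_class v) = (c u == c v).
Proof.
apply/eqP/eqP => [uv|cuv]; last by apply/val_inj/setP=> w; rewrite !inE cuv.
by apply/eqP; rewrite -mem_glue_class uv mem_glue_class.
Qed.

Lemma glue_classP (A : glue_vertex g) : {u | A = glue_class u}.
Proof.
suff Aex : exists u, A == glue_class u
  by exists (xchoose Aex); exact/eqP/(xchooseP Aex).
have /imsetP[u _ Au] := valP A; exists u.
by apply/eqP/val_inj/setP=> v; rewrite Au !inE gluedP.
Qed.

Definition glue_repr (A : glue_vertex g) : T := c (sval (glue_classP A)).

Lemma glue_repr_class (u : T) : glue_repr (glue_class u) = c u.
Proof.
by apply/eqP; rewrite /glue_repr eq_sym -glue_class_eq; apply/eqP; case: glue_classP.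
Qed.

Lemma sum_glue_vertex (V : nmodType) (F : glue_vertex g -> V) :
  (forall u, c (c u) = c u) ->
  \sum_A F A = \sum_(u | c u == u) F (glue_class u).
Proof.
move=> cK; rewrite (reindex_onto glue_class glue_repr) /=; last first.
  move=> A _; have [u ->] := glue_classP A.
  by apply/eqP; rewrite glue_repr_class glue_class_eq cK.
by apply: eq_bigl => u; rewrite glue_repr_class.
Qed.

Hypothesis noloop : forall u v, e u v -> c u != c v.
Hypothesis simple : forall u v u' v', e u v -> e u' v' ->
  c u = c u' -> c v = c v' -> (u, v) = (u', v').

(** By [noloop] and [simple] the gluing creates neither loops nor parallel edges, so the edges at a
    glued vertex correspond one to one to the edges at the members of its fibre. *)
Lemma sum_glue_rel (V : zmodType) (F : glue_vertex g -> V) (u : T) :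
  \sum_(B | glue_rel e (glue_class u) B) (F (glue_class u) - F B) =
  \sum_(v | c u == c v) \sum_(w | e v w) (F (glue_class v) - F (glue_class w)).
Proof.
rewrite pair_big_dep /= (partition_big (fun s => glue_class s.2)
  (glue_rel e (glue_class u))) /=; last first.
  move=> [v w] /= /andP[cuv evw]; rewrite /glue_rel /= glue_class_eq (eqP cuv) noloop //=.
  apply/exists_inP; exists v; first by rewrite inE.
  by apply/exists_inP; exists w => //; rewrite inE.
apply: eq_bigr => B /andP[_ /exists_inP[v vu /exists_inP[w wB evw]]].
have cuv : c u = c v by apply/eqP; rewrite -mem_glue_class.
have Bw : B = glue_class w.
  have [z Bz] := glue_classP B; move: wB; rewrite Bz mem_glue_class => zw.
  by apply/eqP; rewrite glue_class_eq.
rewrite (big_pred1 (v, w)) /=; first last.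
  move=> [v' w'] /=; apply/idP/eqP.
    case/andP => /andP[/eqP cuv' evw'] /eqP Bw'; apply: simple => //.
      by rewrite -cuv' cuv.
    by apply/eqP; rewrite -glue_class_eq Bw' Bw.
  by case=> -> ->; rewrite cuv eqxx evw Bw eqxx.
have -> : glue_class u = glue_class v by apply/eqP; rewrite glue_class_eq cuv.
by rewrite Bw.
Qed.

End Glue.

(** * Neighbours, walks and distance in a cycle *)

Section CycleRel.

Lemma ordS_addr1 (m : nat) (i : 'I_m.+2) : ordS i = i + 1.
Proof. by apply: val_inj; rewrite /= modnDmr addn1. Qed.

Lemma val_subr_ge (m : nat) (a b : 'I_m.+1) : (a <= b)%N -> b - a = (b - a)%N :> nat.
Proof.
move=> ab; have ltb := ltn_ord b; have lta := ltn_ord a; rewrite /= modnDmr.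
by rewrite (_ : b + _ = b - a + m.+1)%N ?modnDr ?modn_small; lia.
Qed.

Lemma val_subr_lt (m : nat) (a b : 'I_m.+1) :
  (b < a)%N -> b - a = (m.+1 + b - a)%N :> nat.
Proof.
by move=> ba; have lta := ltn_ord a; rewrite /= modnDmr modn_small; lia.
Qed.

Lemma val_oppr (n : nat) (k : 'I_n.+1) : k != 0 -> (- k)%R = (n.+1 - k)%N :> nat.
Proof.
by move=> k0; rewrite /= modn_small // ltn_subrL lt0n k0.
Qed.

Lemma val_subr1 (n : nat) (k : 'I_n.+2) : k != 0 -> k = (k - 1)%R.+1 :> nat.
Proof. by move=> k0; rewrite val_subr_ge ?subn1 ?prednK // lt0n. Qed.

Lemma cycle_relE (m : nat) (a b : 'I_m.+2) :
  cycle_rel a b = (b == a + 1) || (b == a - 1).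
Proof. by rewrite /cycle_rel /= !ordS_addr1 (eq_sym a) (can2_eq (addrK 1) (subrK 1)). Qed.

Lemma sum_cycle_rel (V : nmodType) (m : nat) (F : 'I_m.+3 -> V) (a : 'I_m.+3) :
  \sum_(b | cycle_rel a b) F b = F (a + 1) + F (a - 1).
Proof.
under eq_bigl do rewrite cycle_relE.
have neq : a - 1 != a + 1.
  rewrite -subr_eq0 opprD addrACA subrr add0r -opprD oppr_eq0.
  by [].
rewrite (bigD1 (a + 1)) ?eqxx //= (big_pred1 (a - 1)) // => b /=.
by rewrite andb_orl andbN /=; case: (eqVneq b (a - 1)) => // ->.
Qed.

(** [a] and [b] count the forward and the backward steps. *)
Lemma cycle_path_last (m : nat) (x : 'I_m.+2) (s : seq 'I_m.+2) :
  path (@cycle_rel m.+2) x s ->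
  exists a b, (a + b = size s)%N /\ last x s + b%:R = x + a%:R.
Proof.
elim: s x => [|z s IHs] x /=; first by exists 0%N, 0%N.
rewrite cycle_relE => /andP[xz /IHs[a [b [abs lab]]]].
case/orP: xz lab => /eqP -> lab; [exists a.+1, b | exists a, b.+1]; split; try lia.
  by rewrite lab -addrA -mulrS.
by rewrite mulrSr addrA lab addrAC subrK.
Qed.

Lemma cycle_walk (m k : nat) (x d : 'I_m.+2) : d = 1 \/ d = - 1 ->
  exists s, [/\ path (@cycle_rel m.+2) x s, last x s = x + d *+ k & size s = k].
Proof.
move=> d1; elim: k x => [|k IHk] x; first by exists [::]; rewrite addr0.
have [s [xs ls ss]] := IHk (x + d); exists (x + d :: s); split=> /=.
- by rewrite cycle_relE xs andbT; case: d1 => ->; rewrite eqxx ?orbT.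
- by rewrite ls mulrS addrA.
- by rewrite ss.
Qed.

Lemma gdist_cycle (m : nat) (x y : 'I_m.+2) (d := y - x) :
  let p := gdist (@cycle_rel m.+2) x y in p = d \/ p = (m.+2 - d)%N.
Proof.
move=> p; have dE : (d : nat)%:R = d by exact: natr_Zp.
have dm : (d < m.+2)%N by [].
have [s1 [xs1 ls1 ss1]] := @cycle_walk m d x 1 (or_introl erefl).
have [s2 [xs2 ls2 ss2]] := @cycle_walk m (m.+2 - d) x (- 1) (or_intror erefl).
rewrite dE addrC subrK in ls1.
have m0 : m.+2%:R = 0 :> 'I_m.+2 by exact: (@pchar_Zp m.+2).
rewrite mulNrn natrB 1?ltnW // m0 dE sub0r opprK addrC subrK in ls2.
have xy : connect (@cycle_rel m.+2) x y by apply/connectP; exists s1.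
have [[s [xs ls sp]] minp] := gdistP xy.
have := minp _ xs1 ls1; have := minp _ xs2 ls2; rewrite ss1 ss2 -/p => pd2 pd1.
have [a [b [abs]]] := cycle_path_last xs; rewrite ls sp -/p in abs *.
move/(congr1 (fun z => z - x)); rewrite addrAC -/d -{1}dE -natrD [x + _]addrC addrK.
move/(congr1 (fun z : 'I_m.+2 => z : nat)); rewrite !(@Zp_nat m).
move: (nat_of_ord d) dm pd1 pd2 => k km pd1 pd2 /= e.
(* Here [k + b] and [a] are congruent and [a < m.+2]. Without wrap-around [a = k + b], whence
   [p = k]; otherwise [b <= m.+2 - k] forces [k + b = m.+2] and [a = 0]. *)
have [dbm|dbm] := ltnP (k + b)%N m.+2; first by rewrite !modn_small in e; lia.
have dbE : (k + b = m.+2)%N by lia.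
rewrite dbE modnn modn_small in e; lia.
Qed.

End CycleRel.

(** * Resistances and unit-current potential on one cycle *)

Section Cycle.

Variable R : realFieldType.

(** Two arcs in parallel, of lengths [d] and [m.+1 - d], where [d] is the residue of [b - a]. *)
Definition cycle_res (m : nat) (a b : 'I_m.+1) : R :=
  (nat_of_ord (b - a)%R)%:R * (m.+1%:R - (nat_of_ord (b - a)%R)%:R) / m.+1%:R.

Lemma cycle_res_le (m : nat) (a b : 'I_m.+1) : (a <= b)%N ->
  cycle_res a b = (b%:R - a%:R) * (m.+1%:R - (b%:R - a%:R)) / m.+1%:R.
Proof. by move=> ab; rewrite /cycle_res val_subr_ge // natrB. Qed.

Lemma cycle_res0l (m : nat) (a : 'I_m.+1) :
  cycle_res 0 a = a%:R * (m.+1%:R - a%:R) / m.+1%:R.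
Proof. by rewrite /cycle_res subr0. Qed.

Lemma cycle_resC (m : nat) (a b : 'I_m.+1) : cycle_res a b = cycle_res b a.
Proof.
wlog ab : a b / (a < b)%N.
  by move=> W; case: (ltngtP a b) => [/W//|/W//|/val_inj->].
rewrite cycle_res_le 1?ltnW // /cycle_res val_subr_lt //.
by rewrite natrB ?natrD; [congr (_ / _); ring | have := ltn_ord b; lia].
Qed.

Lemma cycle_resxx (m : nat) (a : 'I_m.+1) : cycle_res a a = 0.
Proof. by rewrite /cycle_res subrr !mul0r. Qed.

Lemma cycle_resD (m : nat) (a b c : 'I_m.+1) :
  cycle_res (a + c) (b + c) = cycle_res a b.
Proof. by rewrite /cycle_res opprD addrACA subrr addr0. Qed.

(** As a function of the arc length [d], [cycle_res] is quadratic with constant second difference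
    [- 2 / m.+3]; the point mass is its kink at [d = 0]. *)
Lemma cycle_res_laplacian (m : nat) (a b : 'I_m.+3) :
  \sum_(z | cycle_rel a z) (cycle_res a b - cycle_res z b)
  = 2 / m.+3%:R - 2 * (a == b)%:R.
Proof.
rewrite sum_cycle_rel.
have -> : cycle_res (a + 1) b = cycle_res 1 (b - a).
  by rewrite -(cycle_resD 1 (b - a) a) subrK [1 + a]addrC.
have -> : cycle_res (a - 1) b = cycle_res (- 1) (b - a).
  by rewrite -(cycle_resD (- 1) (b - a) a) subrK [- 1 + a]addrC.
have -> : cycle_res a b = cycle_res 0 (b - a).
  by rewrite -(cycle_resD 0 (b - a) a) subrK add0r.
rewrite -(subr_eq0 a) -oppr_eq0 opprB.
have -> : -1 = ord_max :> 'I_m.+3 by apply: val_inj; rewrite /= modn_small.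
move: (b - a) => d; have dm : (d <= m.+2)%N by rewrite -ltnS.
have M0 : m.+3%:R != 0 :> R by rewrite pnatr_eq0.
have [->|d0] := eqVneq d 0.
  rewrite !(cycle_resC _ 0) cycle_resxx !cycle_res_le //=.
  by move: M0; rewrite -!natr1 => M0; field.
have d_gt0 : (0 < d)%N by rewrite lt0n.
rewrite (cycle_resC ord_max) !cycle_res_le //=.
by move: M0; rewrite -!natr1 => M0; field.
Qed.

Lemma sum_cycle_res (m : nat) (b : 'I_m.+1) :
  \sum_a cycle_res a b = (m.+1%:R ^+ 2 - 1) / 6.
Proof.
have S k (M : R) : \sum_(i < k) i%:R * (M - i%:R) =
    k%:R * (k%:R - 1) * (3 * M - 2 * k%:R + 1) / 6.
  elim: k => [|k IHk]; first by rewrite big_ord0 !mul0r.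
  by rewrite big_ord_recr /= IHk -natr1; field.
rewrite (reindex_inj (@addIr _ b)) /=.
transitivity ((\sum_(i < m.+1) i%:R * (m.+1%:R - i%:R)) / m.+1%:R : R).
  rewrite mulr_suml; apply: eq_bigr => i _.
  by rewrite -{2}[b]add0r cycle_resD cycle_resC cycle_res_le // subr0.
have M0 : 1 + m%:R != 0 :> R by rewrite nat1r pnatr_eq0.
by rewrite S; field.
Qed.

Variables (m : nat) (x y : 'I_m.+1).

(* [cycle_height] is the potential of the unit current from x to y, normalised
   to vanish at x.  As seen from x and y, the cycle with terminal a is a
   Y-network whose third leg has resistance [cycle_stub a]. *)
Definition cycle_height (a : 'I_m.+1) : R :=
  (cycle_res x y + cycle_res a x - cycle_res a y) / 2.

Definition cycle_stub (a : 'I_m.+1) : R :=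
  (cycle_res a x + cycle_res a y - cycle_res x y) / 2.

Lemma cycle_height_l : cycle_height x = 0.
Proof. by rewrite /cycle_height cycle_resxx addr0 subrr mul0r. Qed.

Lemma cycle_height_r : cycle_height y = cycle_res x y.
Proof. by rewrite /cycle_height cycle_resxx (cycle_resC y); field. Qed.

Lemma cycle_stub_l : cycle_stub x = 0.
Proof. by rewrite /cycle_stub cycle_resxx add0r subrr mul0r. Qed.

Lemma cycle_stub_r : cycle_stub y = 0.
Proof. by rewrite /cycle_stub cycle_resxx (cycle_resC y) addr0 subrr mul0r. Qed.

Lemma cycle_stubD_height (a : 'I_m.+1) :
  cycle_stub a + cycle_height a = cycle_res x a.
Proof. by rewrite /cycle_stub /cycle_height (cycle_resC x a); field. Qed.

Lemma cycle_stubB_height (a : 'I_m.+1) :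
  cycle_stub a + (cycle_res x y - cycle_height a) = cycle_res y a.
Proof. by rewrite /cycle_stub /cycle_height (cycle_resC y a); field. Qed.

Lemma sum_cycle_height :
  \sum_a cycle_height a = m.+1%:R * cycle_res x y / 2.
Proof.
rewrite -mulr_suml !big_split /= sumrN !sum_cycle_res sumr_const card_ord.
by rewrite -mulr_natl; field.
Qed.

Lemma sum_cycle_stub :
  \sum_a cycle_stub a = (m.+1%:R ^+ 2 - 1) / 6 - m.+1%:R * cycle_res x y / 2.
Proof.
rewrite -mulr_suml !big_split /= !sum_cycle_res sumr_const card_ord.
by rewrite -mulr_natl; field.
Qed.

(** The height is piecewise linear, rising along one arc from 0 at [x] to [cycle_res x y] at [y] and
    falling along the other, so the sum splits into two sums of squares. *)
Lemma sum_cycle_height_sqr : \sum_a cycle_height a ^+ 2 =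
  m.+1%:R * cycle_res x y ^+ 2 / 3 + cycle_res x y / 6.
Proof.
have S k (c : R) : \sum_(i < k) (c - i%:R) ^+ 2 =
    k%:R * c ^+ 2 - c * k%:R * (k%:R - 1) + k%:R * (k%:R - 1) * (2 * k%:R - 1) / 6.
  elim: k => [|k IHk]; first by rewrite big_ord0; ring.
  by rewrite big_ord_recr /= IHk -natr1; field.
rewrite (reindex_inj (@addIr _ x)) /=; set t := y - x.
have M0 : 1 + m%:R != 0 :> R by rewrite nat1r pnatr_eq0.
have rE : cycle_res x y = cycle_res 0 t by rewrite -(cycle_resD 0 t x) subrK add0r.
have hE (a : 'I_m.+1) : cycle_height (a + x) =
    if (a < t)%N then a%:R * (m.+1%:R - t%:R) / m.+1%:R
    else (m.+1%:R - a%:R) * t%:R / m.+1%:R.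
  rewrite /cycle_height rE -{2}[x]add0r cycle_resD.
  rewrite -[y](subrK x) cycle_resD -/t (cycle_resC a 0).
  have [lt_at|le_ta] := ltnP a t; last rewrite (cycle_resC a).
    by rewrite !cycle_res0l cycle_res_le 1?ltnW //; field.
  by rewrite !cycle_res0l cycle_res_le //; field.
under eq_bigr do rewrite hE.
rewrite rE cycle_res0l.
have : (t <= m.+1)%N by rewrite ltnW.
move: (nat_of_ord t) => k km.
transitivity (\sum_(0 <= i < m.+1) (if (i < k)%N
    then i%:R * (m.+1%:R - k%:R) / m.+1%:R
    else (m.+1%:R - i%:R) * k%:R / m.+1%:R) ^+ 2 : R); first by rewrite big_mkord.
rewrite (@big_cat_nat _ _ _ k) //=.
(* Writing [0 - i] makes this an instance of [S] with [c = 0]. *)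
rewrite (@eq_big_nat _ _ _ 0 k _ (fun i => (0 - i%:R) ^+ 2
    * ((m.+1%:R - k%:R) / m.+1%:R) ^+ 2)) => [|i /andP[_ ->]]; last first.
  by rewrite sub0r sqrrN -exprMn mulrA.
rewrite (@eq_big_nat _ _ _ k m.+1 _ (fun i => (m.+1%:R - i%:R) ^+ 2
    * (k%:R / m.+1%:R) ^+ 2)) => [|i /andP[ki _]]; last first.
  by rewrite ltnNge ki -exprMn mulrA.
rewrite -!mulr_suml big_mkord S -[X in \sum_(X <= _ < _) _]add0n big_addn big_mkord.
rewrite (eq_bigr (fun i : 'I__ => (m.+1%:R - k%:R - i%:R) ^+ 2)) => [|i _]; last first.
  by rewrite natrD; congr (_ ^+ 2); ring.
by rewrite S natrB //; field; exact: M0.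
Qed.

End Cycle.

(** * Laplacians of the height and the stub on the cycle *)

Section CycleLaplacian.

Variables (R : realFieldType) (m : nat) (x y : 'I_m.+3).

Lemma cycle_height_laplacian (a : 'I_m.+3) :
  \sum_(z | cycle_rel a z) (cycle_height R x y a - cycle_height R x y z)
  = (a == y)%:R - (a == x)%:R.
Proof.
transitivity (2^-1 * (\sum_(z | cycle_rel a z) (cycle_res R a x - cycle_res R z x)
    - \sum_(z | cycle_rel a z) (cycle_res R a y - cycle_res R z y))).
  by rewrite -sumrB mulr_sumr; apply: eq_bigr => z _; rewrite /cycle_height; field.
by rewrite !cycle_res_laplacian; move: (2 / m.+3%:R) => k; field.
Qed.

Lemma cycle_stub_laplacian (a : 'I_m.+3) :
  \sum_(z | cycle_rel a z) (cycle_stub R x y a - cycle_stub R x y z)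
  = 2 / m.+3%:R - (a == x)%:R - (a == y)%:R.
Proof.
transitivity (2^-1 * (\sum_(z | cycle_rel a z) (cycle_res R a x - cycle_res R z x)
    + \sum_(z | cycle_rel a z) (cycle_res R a y - cycle_res R z y))).
  by rewrite -big_split mulr_sumr; apply: eq_bigr => z _; rewrite /cycle_stub /=; field.
by rewrite !cycle_res_laplacian; move: (2 / m.+3%:R) => k; field.
Qed.

End CycleLaplacian.

(** * Closed forms for polynomial sums *)

Lemma sum_affine3 (R : realFieldType) (I : finType) (P : pred I)
    (f1 f2 f3 : I -> R) (k0 k1 k2 k3 : R) :
  \sum_(a | P a) (k0 + k1 * f1 a + k2 * f2 a + k3 * f3 a)
  = k0 * \sum_(a | P a) 1 + k1 * (\sum_(a | P a) f1 a)
    + k2 * (\sum_(a | P a) f2 a) + k3 * \sum_(a | P a) f3 a.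
Proof.
by rewrite !mulr_sumr -!big_split; apply: eq_bigr => a _; rewrite mulr1.
Qed.

(** [K] will be the offset between two copies. Only moments of [f] and [g] survive the expansion;
    terms linear in [g] cancel between [a] and [b]. *)
Lemma sum_sum_quadratic (R : realFieldType) (I : finType) (P : pred I) (f g : I -> R) (K t : R)
    (M := \sum_(a | P a) 1 : R) (Sf := \sum_(a | P a) f a)
    (Sg := \sum_(a | P a) g a) (Sg2 := \sum_(a | P a) g a ^+ 2) :
  \sum_(a | P a) \sum_(b | P b)
    (f a + f b + (K + g b - g a) - (K + g b - g a) ^+ 2 * t)
  = 2 * M * Sf + M ^+ 2 * K - (M ^+ 2 * K ^+ 2 + 2 * M * Sg2 - 2 * Sg ^+ 2) * t.
Proof.
transitivity (\sum_(a | P a) (Sf + M * K + Sg - t * (M * K ^+ 2 + Sg2 + 2 * K * Sg)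
    + M * f a + (- M + 2 * t * K * M + 2 * t * Sg) * g a + (- (t * M)) * g a ^+ 2)).
  apply: eq_bigr => a _.
  transitivity (\sum_(b | P b) (f a + K - g a - t * (K - g a) ^+ 2
     + 1 * f b + (1 - 2 * t * (K - g a)) * g b + (- t) * g b ^+ 2)).
    by apply: eq_bigr => b _; ring.
  by rewrite sum_affine3 -/M -/Sf -/Sg -/Sg2; ring.
by rewrite sum_affine3 -/M -/Sf -/Sg -/Sg2; ring.
Qed.

Lemma sum_natr (R : realFieldType) (k : nat) : \sum_(i < k) i%:R = k%:R * (k%:R - 1) / 2 :> R.
Proof.
elim: k => [|k IHk]; first by rewrite big_ord0 !mul0r.
by rewrite big_ord_recr /= IHk -natr1; field.
Qed.

Lemma sum_natr_sqr (R : realFieldType) (k : nat) :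
  \sum_(i < k) i%:R ^+ 2 = k%:R * (k%:R - 1) * (2 * k%:R - 1) / 6 :> R.
Proof.
elim: k => [|k IHk]; first by rewrite big_ord0 !mul0r.
by rewrite big_ord_recr /= IHk -natr1; field.
Qed.

(** * Glued vertices of the sunflower graph *)

Section SunflowerClasses.

Variables (m n : nat) (x y : 'I_m.+3).
Hypothesis xy : x != y.

Local Notation vertex := ('I_n.+3 * 'I_m.+3)%type.

Definition sunflower_canon (u : vertex) : vertex :=
  if u.2 == y then (u.1 + 1, x) else u.

Local Notation ident := (@sunflower_ident m.+3 n.+3 x y).
Local Notation copies := (@copies_rel m.+3 n.+3).
Local Notation c := sunflower_canon.

Lemma sunflower_canonK (u : vertex) : c (c u) = c u.
Proof. by rewrite {2 3}/c; case: ifP => uy; rewrite /c ?(negPf xy) ?uy. Qed.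

Lemma sunflower_canon_id (u : vertex) : (c u == u) = (u.2 != y).
Proof.
rewrite /c; case: (eqVneq u.2 y) => uy /=; last exact: eqxx.
by apply/eqP => /(congr1 snd) /= e; move: xy; rewrite e uy eqxx.
Qed.

Lemma sunflower_canon_copy_inj (i : 'I_n.+3) (a b : 'I_m.+3) :
  c (i, a) = c (i, b) -> a = b.
Proof.
have one : i + 1 <> i by move/eqP; rewrite -subr_eq0 addrC addKr.
rewrite /c /=; case: eqP => [->|_]; case: eqP => [->|_] //.
- by case=> /one.
- by case=> /esym /one.
- by case.
Qed.

Lemma sunflower_canonP (u v : vertex) :
  connect (relU (ident) [rel a b | ident b a]) u v
  = (c u == c v).
Proof.
set g := relU _ _.
have gC : connect_sym g by apply: sym_connect_sym => a b; rewrite /g /= orbC.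
have gc a : connect g a (c a).
  rewrite /c; case: eqP => // ay; apply: connect1; rewrite /g /sunflower_ident /=.
  by rewrite ay !eqxx ordS_addr1 eqxx.
have identc a b : ident a b -> c a = c b.
  case: a b => [i a] [j b] /and3P[/= /eqP -> /eqP -> /eqP ->].
  by rewrite /c /= eqxx (negPf xy) ordS_addr1.
apply/idP/eqP => [/connectP[s gs ->]|cuv]; last first.
  by apply: connect_trans (gc u) _; rewrite cuv gC.
elim: s u gs => //= w s IHs u /andP[guw /IHs <-].
by case/orP: guw => /identc.
Qed.

Lemma copies_relP (u v : vertex) :
  reflect (u.1 = v.1 /\ cycle_rel u.2 v.2) (copies u v).
Proof. by apply: (iffP andP) => -[/eqP]. Qed.

Lemma cycle_rel_irr (a : 'I_m.+3) : cycle_rel a a = false.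
Proof.
by rewrite cycle_relE -{1 3}[a]addr0 !(inj_eq (addrI a)) (eq_sym 0 (- 1)) oppr_eq0.
Qed.

Lemma copies_rel_noloop (u v : vertex) : copies u v -> c u != c v.
Proof.
case: u v => [i a] [j b] /copies_relP[/= <- ab]; apply/eqP.
by move/sunflower_canon_copy_inj => ba; rewrite ba cycle_rel_irr in ab.
Qed.

Lemma sunflower_canon_eq (u v : vertex) : c u = c v ->
  [\/ u = v, [/\ u.2 = y, v.2 = x & v.1 = u.1 + 1]
           | [/\ v.2 = y, u.2 = x & u.1 = v.1 + 1]].
Proof.
case: u v => [i a] [j b]; rewrite /c /=; case: eqP => [->|_]; case: eqP => [->|_].
- by move/eqP; rewrite xpair_eqE => /andP[/eqP /addIr -> _]; constructor 1.
- by case=> <- <-; constructor 2.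
- by case=> -> ->; constructor 3.
- by constructor 1.
Qed.

(** Gluing both ends of edges from different copies would force [i = i + 1], [i = i + 1 + 1] or an
    edge from [y] to itself; the second is excluded by having at least three copies. *)
Lemma copies_rel_simple (u v u' v' : vertex) :
  copies u v -> copies u' v' ->
  c u = c u' -> c v = c v' -> (u, v) = (u', v').
Proof.
have one (i : 'I_n.+3) : i <> i + 1.
  by rewrite -{1}[i]addr0 => /addrI/eqP.
have two (i : 'I_n.+3) : i <> i + 1 + 1.
  by rewrite -addrA -{1}[i]addr0 => /addrI/eqP.
case: u v u' v' => [i a] [j b] [i' a'] [j' b'].
move=> /copies_relP[/= <- ab] /copies_relP[/= <- ab'].
move=> /sunflower_canon_eq[[<- <-]|[/= ay a'x i'E]|[/= a'y ax iE]].
- by move=> /sunflower_canon_copy_inj ->.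
- case/sunflower_canon_eq => [[e _]|[/= bE _ _]|[/= _ _ e]].
  + by case: (@one i); rewrite -i'E.
  + by rewrite ay bE cycle_rel_irr in ab.
  + by case: (@two i); rewrite -i'E.
- case/sunflower_canon_eq => [[e _]|[/= _ _ e]|[/= bE _ _]].
  + by case: (@one i'); rewrite -iE.
  + by case: (@two i'); rewrite -iE.
  + by rewrite a'y bE cycle_rel_irr in ab'.
Qed.

End SunflowerClasses.

(** * Resistance distances in the sunflower graph *)

Section SunflowerResistance.

Variables (R : realFieldType) (m n : nat) (x y : 'I_m.+3).
Hypothesis xy : x != y.

Local Notation vertex := ('I_n.+3 * 'I_m.+3)%type.
Local Notation copies := (@copies_rel m.+3 n.+3).
Local Notation c := (@sunflower_canon m n x y).
Local Notation r := (cycle_res R x y).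
Local Notation h := (cycle_height R x y).
Local Notation s := (cycle_stub R x y).
Local Notation N := (n.+3%:R : R).

Lemma cycle_res_neq0 : r != 0.
Proof.
rewrite /cycle_res -natrB 1?ltnW // !mulf_neq0 ?invr_eq0 ?pnatr_eq0 -?lt0n ?subn_gt0 //.
by rewrite lt0n -[_ == _]/(y - x == 0) subr_eq0 eq_sym.
Qed.

(* Unrolling the ring of n copies, each of resistance r between its terminals,
   from the copy of [u] onwards, [v] lies [sunflower_gap u v] further along. *)
Definition sunflower_gap (u v : vertex) : R :=
  (nat_of_ord (v.1 - u.1)%R)%:R * r + h v.2 - h u.2.

(** For two vertices of one copy, the other copies act as a resistor [(N - 1) * r] across its
    terminals; this rank-one change lowers [cycle_res] by the last term. *)
Definition sunflower_res (u v : vertex) : R :=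
  (if u.1 == v.1 then cycle_res R u.2 v.2
   else s u.2 + s v.2 + sunflower_gap u v)
  - sunflower_gap u v ^+ 2 / (N * r).

Local Notation gap := sunflower_gap.
Local Notation rho := sunflower_res.

Lemma sunflower_gapE (i j : 'I_n.+3) (a b : 'I_m.+3) :
  gap (i, a) (j, b) = (nat_of_ord (j - i)%R)%:R * r + h b - h a.
Proof. by []. Qed.

Lemma sunflower_resE (i j : 'I_n.+3) (a b : 'I_m.+3)
    (D := (nat_of_ord (j - i)%R)%:R * r + h b - h a) :
  rho (i, a) (j, b) =
  (if i == j then cycle_res R a b else s a + s b + D) - D ^+ 2 / (N * r).
Proof. by []. Qed.

Lemma sunflower_resxx (u : vertex) : rho u u = 0.
Proof.
by rewrite /rho /gap eqxx cycle_resxx subrr mul0r !add0r subrr expr0n mul0r oppr0.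
Qed.

(** Between distinct copies the two gaps add up to the full ring [N * r], and [D - D ^+ 2 / (N * r)]
    is invariant under replacing [D] by [N * r - D]. *)
Lemma sunflower_resC (u v : vertex) : rho u v = rho v u.
Proof.
rewrite /rho (eq_sym v.1); case: eqVneq => [uv|uv].
  by rewrite cycle_resC /gap uv subrr !mul0r !add0r -sqrrN opprB.
have -> : gap v u = N * r - gap u v.
  rewrite /gap -(opprB v.1 u.1) val_oppr ?subr_eq0 1?eq_sym //.
  by rewrite natrB 1?ltnW //; ring.
have r0 := cycle_res_neq0.
by field; rewrite r0 addrC -(natrD _ n 3) pnatr_eq0 addn3.
Qed.

(** This lets [rho] descend to glued vertices. The branch of the conditional changes only when [v]
    lies in copy [i] or [i + 1], and there the stub identities reconcile the two formulas. *)
Lemma sunflower_res_canonl (u v : vertex) : rho (c u) v = rho u v.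
Proof.
case: u v => [i a] [j b]; rewrite /c /=; case: eqP => //= ->.
have r0 := cycle_res_neq0.
have N0 : 3%:R + n%:R != 0 :> R by rewrite -(natrD _ 3 n) pnatr_eq0.
have i1 : i + 1 != i by rewrite -{2}[i]addr0 (inj_eq (addrI i)).
rewrite !sunflower_resE cycle_height_l cycle_height_r cycle_stub_l cycle_stub_r.
(* Seen from copy [i + 1], copy [i] lies almost a full turn ahead, at offset [N - 1]. *)
have [<-|ij] := eqVneq i j.
  have -> : (nat_of_ord (i - (i + 1))%R)%:R = N - 1.
    by rewrite opprD addNKr val_oppr // natrB.
  have -> : (nat_of_ord (i - i)%R)%:R = 0 :> R by rewrite subrr.
  by rewrite (negPf i1) -(cycle_stubB_height R x y); field; rewrite r0.
have [<-|i1j] := eqVneq (i + 1) j.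
  have -> : (nat_of_ord (i + 1 - (i + 1))%R)%:R = 0 :> R by rewrite subrr.
  have -> : (nat_of_ord (i + 1 - i)%R)%:R = 1 :> R by rewrite addrC addKr.
  by rewrite -(cycle_stubD_height R x y); ring.
have -> : (nat_of_ord (j - i)%R)%:R = (nat_of_ord (j - (i + 1))%R)%:R + 1 :> R.
  by rewrite val_subr1 ?subr_eq0 1?eq_sym // opprD addrA natr1.
by ring.
Qed.

Lemma sum_copies_rel (V : nmodType) (F : vertex -> V) (i : 'I_n.+3) (a : 'I_m.+3) :
  \sum_(z | copies (i, a) z) F z = \sum_(b | cycle_rel a b) F (i, b).
Proof.
rewrite (reindex_onto (pair i) snd) /=; last first.
  by case=> [j b] /copies_relP[/= ->].
by apply: eq_bigl => b; rewrite /copies_rel /= !eqxx andbT.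
Qed.

(** The second-order term produced by the squared gap; being independent of [v], it goes into
    [tau]. *)
Definition cycle_energy (a : 'I_m.+3) : R :=
  \sum_(z | cycle_rel a z) (h a - h z) ^+ 2.

Lemma sunflower_copy_laplacian (w v : vertex) :
  \sum_(z | copies w z) (rho w v - rho z v) =
  2 / m.+3%:R + cycle_energy w.2 / (N * r)
  + 2 * gap w v * ((w.2 == y)%:R - (w.2 == x)%:R) / (N * r)
  - 2 * (if w.1 == v.1 then w.2 == v.2 else w.2 == y)%:R.
Proof.
case: w v => [i a] [j b]; rewrite sum_copies_rel [(_, _).1]/= [(_, _).2]/=.
set D := gap _ _.
pose F z : R := if i == j then cycle_res R a b - cycle_res R z b
  else (s a - s z) - (h a - h z).
transitivity (\sum_(z | cycle_rel a z) (F z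
   + 2 * D / (N * r) * (h a - h z) + (h a - h z) ^+ 2 / (N * r))).
  apply: eq_bigr => z _; rewrite !sunflower_resE /F /D /gap /=.
  by case: ifP => _; ring.
rewrite !big_split /= -mulr_sumr -mulr_suml cycle_height_laplacian.
suff -> : \sum_(z | cycle_rel a z) F z =
    2 / m.+3%:R - 2 * (if i == j then a == b else a == y)%:R.
  by rewrite /cycle_energy; ring.
rewrite /F; case: ifP => _; first exact: cycle_res_laplacian.
by rewrite sumrB cycle_stub_laplacian cycle_height_laplacian; ring.
Qed.

Lemma sum_sunflower_fiber (V : nmodType) (F : vertex -> V) (u : vertex) :
  u.2 != y -> \sum_(w | c u == c w) F w
  = F u + (if u.2 == x then F (u.1 - 1, y) else 0).
Proof.
move=> uy; rewrite (bigD1 u) ?eqxx //=; congr (_ + _).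
have fib w : (c u == c w) && (w != u) -> [/\ w.2 = y, u.2 = x & u.1 = w.1 + 1].
  case/andP => /eqP /sunflower_canon_eq[-> /eqP //|[uy' _ _]|//] _.
  by rewrite uy' eqxx in uy.
case: ifP => ux; last by rewrite big1 // => w /fib[_ ux' _]; rewrite ux' eqxx in ux.
rewrite (big_pred1 (u.1 - 1, y)) // => -[i a]; apply/idP/eqP => [/fib[/= -> _ ->]|].
  by rewrite addrK.
move=> [-> ->]; rewrite {1}/c (negPf uy) {1}/c /= eqxx subrK -(eqP ux) -surjective_pairing.
by rewrite eqxx; apply: contraNneq uy => <-.
Qed.

(** The terms linear in the gap have opposite signs at the two members of a glued vertex, so apart
    from the point mass nothing depends on [v], as [resistance_eq] requires. *)
Lemma sunflower_laplacian (u v : vertex) : u.2 != y -> v.2 != y ->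
  \sum_(w | c u == c w) \sum_(z | copies w z) (rho w v - rho z v) =
  \sum_(w | c u == c w)
    (2 / m.+3%:R + cycle_energy w.2 / (N * r) - 2 * (w.2 == y)%:R)
  - 2 * (c u == c v)%:R.
Proof.
move=> uy vy; rewrite !sum_sunflower_fiber // !sunflower_copy_laplacian.
case: u v uy vy => [i a] [j b] /= ay by_; rewrite (negPf ay).
have -> : (c (i, a) == c (j, b)) = (i == j) && (a == b).
  by rewrite /c /= (negPf ay) (negPf by_).
rewrite !(eq_sym y) eqxx (negPf xy).
case: eqVneq => [ax|ax]; last by case: (eqVneq i j) => _ /=; ring.
rewrite !sunflower_gapE ax cycle_height_l cycle_height_r (eq_sym _ b) (negPf by_).
have r0 := cycle_res_neq0.
move: (2 / m.+3%:R) (cycle_energy _) (cycle_energy _) => K E1 E2.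
have N0 : 3 + n%:R != 0 :> R by rewrite -(natrD _ 3 n) pnatr_eq0.
(* If [v] lies in copy [i - 1], the gaps from its [y] and from [x] of copy [i] differ by a full turn
   [N * r]; this jump supplies the [- 2] missing from the point mass at [y]. *)
have [<-|ij] := eqVneq (i - 1) j.
  have -> : (nat_of_ord (i - 1 - i)%R)%:R = N - 1.
    by rewrite addrC addKr val_oppr // natrB.
  have -> : (nat_of_ord (i - 1 - (i - 1))%R)%:R = 0 :> R by rewrite subrr.
  rewrite (_ : (i == i - 1) = false) /=; first by field; rewrite r0.
  by rewrite -{1}[i]addr0 (inj_eq (addrI i)) eq_sym oppr_eq0.
have -> : (nat_of_ord (j - (i - 1))%R)%:R = (nat_of_ord (j - i)%R)%:R + 1 :> R.
  by rewrite val_subr1 ?subr_eq0 1?eq_sym // opprB addrA addrAC addrK natr1.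
by case: (eqVneq i j) => _ /=; field; rewrite r0.
Qed.

Local Notation canonP := (@sunflower_canonP m n x y xy).
Local Notation cls := (glue_class canonP).

Lemma resistance_sunflower (u v : vertex) :
  resistance (sunflower_rel n.+3 x y) R (cls u) (cls v) = rho u v.
Proof.
pose rep := glue_repr canonP.
have repE w z : rho (rep (cls w)) (rep (cls z)) = rho w z.
  by rewrite /rep !glue_repr_class sunflower_res_canonl sunflower_resC
    sunflower_res_canonl sunflower_resC.
rewrite -(repE u v); set U := cls u; set V := cls v; move: U V => {u v}.
apply: (@resistance_eq _ _ _ (fun A B => rho (rep A) (rep B))
  (fun A => \sum_(w | c (rep A) == c w)
    (2 / m.+3%:R + cycle_energy w.2 / (N * r) - 2 * (w.2 == y)%:R))).
- exact: sunflower_rel_sym.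
- by move=> A; exact: sunflower_resxx.
- by move=> A B; exact: sunflower_resC.
move=> A B.
(* Canonical members avoid [y], as [sunflower_laplacian] demands. *)
have repK C : {u | C = cls u & u.2 != y /\ rep C = u}.
  have [u ->] := glue_classP canonP C.
  exists (c u); last split.
  - by apply/eqP; rewrite glue_class_eq sunflower_canonK.
  - by rewrite -(sunflower_canon_id xy) sunflower_canonK.
  - exact: glue_repr_class.
have [u -> [uy ->]] := repK A; have [v -> [vy ->]] := repK B.
rewrite glue_class_eq -sunflower_laplacian //.
pose F C := rho (rep C) v.
have FE w : F (cls w) = rho w v.
  by rewrite /F /rep glue_repr_class sunflower_res_canonl.
transitivity (\sum_(C | glue_rel copies (cls u) C) (F (cls u) - F C)).
  by apply: eq_bigr => C _; rewrite FE.
rewrite sum_glue_rel.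
- by apply: eq_bigr => w _; apply: eq_bigr => z _; rewrite !FE.
- exact: copies_rel_noloop.
- exact: copies_rel_simple.
Qed.

(** * Summation to the Kirchhoff index *)

Lemma sum_neq (F : 'I_m.+3 -> R) : \sum_(a | a != y) F a = \sum_a F a - F y.
Proof. by rewrite [X in _ = X - _](bigD1 y) //= addrAC subrr add0r. Qed.

Lemma kirchhoff_sunflower (M := m.+3%:R : R) :
  kirchhoff (sunflower_rel n.+3 x y) R =
    N * (M * r) * (N ^+ 2 * (M - 1) ^+ 2 + M ^+ 2 * (4 - 6 * N) + 6 * M * N - 1)
      / (12 * M)
    - N * (M ^+ 3 + M - 2 - 2 * N * (M - 1) ^+ 2 * (M + 1)) / 12.
Proof.
have sumV (F : sunflower_vertex n.+3 x y -> R) :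
    \sum_A F A = \sum_i \sum_(a | a != y) F (cls (i, a)).
  rewrite (sum_glue_vertex canonP F (sunflower_canonK xy)).
  rewrite pair_big_dep; apply: eq_big => [[i a]|[i a] _] //=.
  by rewrite sunflower_canon_id.
rewrite /kirchhoff sumV; under eq_bigr do under eq_bigr do rewrite sumV.
pose t := (N * r)^-1.
(* [k] is the cyclic offset between two copies. The formula for distinct copies is used at [k = 0]
   too, and [C] corrects the pairs inside one copy. *)
pose G (k : nat) := \sum_(a | a != y) \sum_(b | b != y)
  (s a + s b + (k%:R * r + h b - h a) - (k%:R * r + h b - h a) ^+ 2 * t).
pose C := \sum_(a | a != y) \sum_(b | b != y)
   (cycle_res R a b - s a - s b - h b + h a).
transitivity (2^-1 * \sum_(i < n.+3) (\sum_(k < n.+3) G k + C)).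
  congr (_ * _); apply: eq_bigr => i _; rewrite exchange_big /=.
  rewrite (reindex_inj (@addIr _ i)) (bigD1 0) //=.
  rewrite [X in _ = X + _](bigD1 0) //= addrAC; congr (_ + _); last first.
    apply: eq_bigr => k k0; apply: eq_bigr => a _; apply: eq_bigr => b _.
    rewrite resistance_sunflower sunflower_resE addrK ifF //.
    by rewrite eq_sym -subr_eq0 addrK (negPf k0).
  rewrite -big_split; apply: eq_bigr => a _; rewrite -big_split.
  apply: eq_bigr => b _ /=; rewrite resistance_sunflower sunflower_resE.
  rewrite add0r eqxx /t (_ : (nat_of_ord (i - i)%R)%:R = 0 :> R) ?subrr //.
  by ring.
(* Omitting [y] lowers the count to [M - 1] and removes [r] from the height sum and [r ^+ 2] from
   the sum of squares; the stub vanishes at [y]. *)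
have GE k : G k = 2 * (M - 1) * ((M ^+ 2 - 1) / 6 - M * r / 2) + (M - 1) ^+ 2 * (k%:R * r)
   - ((M - 1) ^+ 2 * (k%:R * r) ^+ 2
      + 2 * (M - 1) * (M * r ^+ 2 / 3 + r / 6 - r ^+ 2)
      - 2 * (M * r / 2 - r) ^+ 2) * t.
  rewrite /G sum_sum_quadratic !sum_neq sum_cycle_stub sum_cycle_height sum_cycle_height_sqr.
  by rewrite cycle_stub_r cycle_height_r sumr_const card_ord -/M; ring.
(* The heights cancel; omitting [y] in both indices leaves [M - 2] full row sums of [cycle_res]. *)
have CE : C = (M - 2) * ((M ^+ 2 - 1) / 6)
   - 2 * (M - 1) * ((M ^+ 2 - 1) / 6 - M * r / 2).
  transitivity (\sum_(a | a != y) ((M ^+ 2 - 1) / 6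
     - ((M ^+ 2 - 1) / 6 - M * r / 2) - (M * r / 2 - r)
     + (-1) * cycle_res R a y + (1 - M) * s a + (M - 1) * h a)).
    apply: eq_bigr => a _.
    transitivity (\sum_(b | b != y) (h a - s a + 1 * cycle_res R b a
        + (-1) * s b + (-1) * h b)).
      by apply: eq_bigr => b _; rewrite (cycle_resC R b); ring.
    rewrite sum_affine3 !sum_neq sum_cycle_res sum_cycle_stub sum_cycle_height.
    rewrite cycle_stub_r cycle_height_r sumr_const card_ord -/M (cycle_resC R y).
    by ring.
  rewrite sum_affine3 !sum_neq sum_cycle_res sum_cycle_stub sum_cycle_height.
  rewrite cycle_stub_r cycle_height_r cycle_resxx sumr_const card_ord -/M.
  by field.
rewrite sumr_const card_ord -[_ *+ n.+3]mulr_natl CE; under eq_bigr do rewrite GE.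
pose alpha := 2 * (M - 1) * ((M ^+ 2 - 1) / 6 - M * r / 2)
  - (2 * (M - 1) * (M * r ^+ 2 / 3 + r / 6 - r ^+ 2) - 2 * (M * r / 2 - r) ^+ 2) * t.
(* [alpha] is the part of [G k] free of [k]; the dummy [0 * 0] fills the last slot of
   [sum_affine3]. *)
rewrite (eq_bigr (fun k : 'I_n.+3 => alpha + (M - 1) ^+ 2 * r * k%:R
    + (- (M - 1) ^+ 2 * r ^+ 2 * t) * k%:R ^+ 2 + 0 * 0)); last first.
  by move=> k _; rewrite /alpha; ring.
rewrite sum_affine3 sum_natr sum_natr_sqr sumr_const card_ord /alpha /t.
have r0 := cycle_res_neq0.
have M0 : M != 0 by rewrite pnatr_eq0.
have N0 : N != 0 by rewrite pnatr_eq0.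
move: (M) N r M0 N0 r0 => M' N' r' M0 N0 r0.
by field; rewrite M0 N0 r0.
Qed.

End SunflowerResistance.

Unset Implicit Arguments.
Set Strict Implicit.

Theorem theorem5p4 (R : realFieldType) (m n p : nat) (x y : 'I_m)
    (hm : (3 <= m)%N) (hn : (3 <= n)%N) (hxy : x != y)
    (hp : p = gdist (@cycle_rel m) x y) :
  kirchhoff (sunflower_rel n x y) R =
    n%:R * (p%:R * m%:R - p%:R ^+ 2)
      * (n%:R ^+ 2 * (m%:R - 1) ^+ 2 + m%:R ^+ 2 * (4 - 6 * n%:R)
         + 6 * m%:R * n%:R - 1) / (12 * m%:R)
    - n%:R * (m%:R ^+ 3 + m%:R - 2
              - 2 * n%:R * (m%:R - 1) ^+ 2 * (m%:R + 1)) / 12.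
Proof.
case: m hm x y hxy hp => [|[|[|m]]] // _ x y xy pE.
case: n hn => [|[|[|n]]] // _; rewrite (kirchhoff_sunflower R n xy).
(* The left side is unchanged when [p] becomes [m.+3 - p], so it does not matter which arc realises
   the distance. *)
suff -> : p%:R * m.+3%:R - p%:R ^+ 2 = m.+3%:R * cycle_res R x y by [].
have M0 : m.+3%:R != 0 :> R by rewrite pnatr_eq0.
rewrite /cycle_res [_ * (_ / _)]mulrC divfK // {}pE.
have [->|->] := gdist_cycle x y; first by ring.
by rewrite natrB 1?ltnW //; ring.
Qed.
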